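(* Let $P$ be a poset, and let $\varphi:P\to P$ be a descending closure operator. Then $\Delta(P)$ collapses onto $\Delta(\varphi(P))$. By symmetry the same is true for an ascending closure operator: if $\varphi:P\to P$ is an ascending closure operator, then $\Delta(P)$ collapses onto $\Delta(\varphi(P))$.
   Context: For a poset $P$, $\Delta(P)$ denotes its nerve (order complex): the simplicial complex whose simplices are all chains of $P$. The image $\varphi(P)\subseteq P$ carries the induced partial order, so $\Delta(\varphi(P))$ is a subcomplex of $\Delta(P)$. An order preserving map $\varphi$ from a poset $P$ to itself is called a descending closure operator if $\varphi^2=\varphi$ and $\varphi(x)\leq x$ for any $x\in P$; it is called an ascending closure operator if $\varphi^2=\varphi$ and $\varphi(x)\geq x$ for any $x\in P$. An elementary collapse of a simplicial complex $X$ is the removal of a pair of nonempty simplices $(\sigma,\tau)$ of $X$ such that $\sigma\subset\tau$, $\dim\tau=\dim\sigma+1$, and $\tau$ is the only simplex of $X$ properly containing $\sigma$. For a simplicial complex $X$ and its subcomplex $Y$, one says that $X$ collapses onto $Y$ if there exists a sequence of elementary collapses leading from $X$ to $Y$.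
   Formalization: The poset P is assumed finite; for infinite P the claim fails, e.g. P = ℕ with φ constantly 0, where no simplex of Δ(P) lies in a unique larger simplex and so no elementary collapse exists. *)

(* Defs.v *)
From HB Require Import structures.
From mathcomp Require Import all_boot all_order.

Set Implicit Arguments.
Unset Strict Implicit.
Unset Printing Implicit Defensive.

Import Order.TTheory.
Local Open Scope order_scope.

(* An abstract simplicial complex on a finite vertex set [V] is a set of        *)
(* subsets of [V] closed under passing to subsets; thus the empty simplex       *)
(* belongs to every nonvoid complex, and dim s = #|s| - 1.                      *)

Section Complexes.
Variable V : finType.
Implicit Types (X Y : {set {set V}}) (s t r : {set V}).

Definition simplicial_complex X : bool :=
  [forall t in X, forall s : {set V}, (s \subset t) ==> (s \in X)].

Definition collapsible_pair X s t : bool :=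
  [&& s \in X, t \in X, s != set0, t != set0,
      s \subset t, #|t| == #|s|.+1
    & [forall r in X, (s \proper r) ==> (r == t)]].

Definition elementary_collapse : rel {set {set V}} := fun X Y =>
  simplicial_complex X
  && [exists s, exists t, collapsible_pair X s t && (Y == X :\: [set s; t])].

(* [connect] is the reflexive-transitive closure, so the sequence of            *)
(* elementary collapses may be empty.                                           *)
Definition collapses_onto X Y : bool :=
  [&& simplicial_complex X, simplicial_complex Y, Y \subset X
    & connect elementary_collapse X Y].

End Complexes.

Section Posets.
Variables (d : Order.disp_t) (P : finPOrderType d).
Implicit Types (A c : {set P}) (phi : P -> P).

Definition chain c : bool := [forall x in c, forall y in c, x >=< y].

(* The nerve of the subposet [A] of [P] with the induced order, as a complex on *)
(* the vertex set [P]; the nerve of [P] itself is [order_complex [set: P]].     *)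
Definition order_complex A : {set {set P}} :=
  [set c : {set P} | (c \subset A) && chain c].

Definition descending_closure phi : Prop :=
  [/\ {homo phi : x y / x <= y},
      forall x, phi (phi x) = phi x
    & forall x, phi x <= x].

Definition ascending_closure phi : Prop :=
  [/\ {homo phi : x y / x <= y},
      forall x, phi (phi x) = phi x
    & forall x, x <= phi x].

End Posets.

(* Main.v *)
Require Import Defs.
From HB Require Import structures.
From mathcomp Require Import all_boot all_order.

Set Implicit Arguments.
Unset Strict Implicit.
Unset Printing Implicit Defensive.

Import Order.TTheory.

(** Call x the root of a chain c if x is the least element of c not fixed by
    the descending closure operator phi. Every fixed y < x satisfies
    y = phi y <= phi x, so adding phi x to c gives a chain with the same root,
    and toggling phi x is a perfect matching on the chains not contained in
    phi(P). To perform it by elementary collapses, take x minimal among the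
    remaining non-fixed vertices and s maximal among the remaining chains
    containing x but not phi x: then s has no proper coface but s + phi x. The
    ascending case is the descending one for the dual order. *)

Section Complexes.
Variable V : finType.
Implicit Types (X Y : {set {set V}}) (r s t : {set V}).

Lemma simplicial_complexP X :
  reflect (forall s t, t \in X -> s \subset t -> s \in X)
          (simplicial_complex X).
Proof.
apply: (iffP forall_inP) => [Xc s t tX st|Xc t tX].
  exact: (implyP (forallP (Xc t tX) s)).
by apply/forallP => s; apply/implyP; apply: Xc.
Qed.

(** If a simplex [v] outside the pair had [s] or [t] as a face, it would properly contain [s], so
    freeness of [s] would give [v = t]. *)
Lemma collapse_simplicial_complex X s t :
  simplicial_complex X -> collapsible_pair X s t ->
  simplicial_complex (X :\: [set s; t]).
Proof.
move=> /simplicial_complexP Xc /and5P[sX tX _ _ /and3P[st _ /forall_inP free]].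
apply/simplicial_complexP => u v; rewrite !inE !negb_or => /andP[/andP[vs vt] vX] uv.
rewrite (Xc u v vX uv) andbT; apply/andP; split; apply: contraNneq vt => uE.
  by apply: (implyP (free v vX)); rewrite properEneq eq_sym vs -uE.
apply: (implyP (free v vX)).
by rewrite properEneq eq_sym vs (subset_trans st) // -uE.
Qed.

End Complexes.

Section DescendingClosure.
Variables (d : Order.disp_t) (P : finPOrderType d) (phi : P -> P).
Hypothesis phi_desc : descending_closure phi.
Implicit Types (X : {set {set P}}) (c r s : {set P}) (x y z : P).

Let phi_homo x y : (x <= y)%O -> (phi x <= phi y)%O.
Proof. by case: phi_desc => h _ _; apply: h. Qed.

Let phiK x : phi (phi x) = phi x.
Proof. by case: phi_desc. Qed.

Let phi_le x : (phi x <= x)%O.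
Proof. by case: phi_desc. Qed.

Lemma mem_codom_closure y : (y \in phi @: [set: P]) = (phi y == y).
Proof.
apply/imsetP/eqP => [[z _ ->] | <-]; first exact: phiK.
by exists y; rewrite ?inE.
Qed.

Lemma chainP c :
  reflect {in c &, forall x y, (x >=< y)%O} (chain c).
Proof.
apply: (iffP forall_inP) => [h x y xc yc|h x xc].
  exact: (forall_inP (h x xc)).
by apply/forall_inP => y; apply: h.
Qed.

Lemma order_complex_simplicial A :
  simplicial_complex (order_complex A : {set {set P}}).
Proof.
apply/simplicial_complexP => s t; rewrite !inE => /andP[tA /chainP tc] st.
rewrite (subset_trans st tA); apply/chainP => x y xs ys.
by apply: tc; apply: (subsetP st).
Qed.

Definition is_root x c :=
  [&& x \in c, phi x != x & [forall y in c, (phi y != y) ==> (x <= y)%O]].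

Lemma is_rootP x c :
  reflect [/\ x \in c, phi x != x & {in c, forall y, phi y != y -> (x <= y)%O}]
          (is_root x c).
Proof.
apply: (iffP and3P) => [[xc xn /forall_inP h]|[xc xn h]]; split=> //.
  by move=> y yc; apply/implyP/h.
by apply/forall_inP => y yc; apply/implyP/h.
Qed.

Lemma is_root_uniq x y c : is_root x c -> is_root y c -> x = y.
Proof.
move=> /is_rootP[xc xn xm] /is_rootP[yc yn ym].
by apply: le_anti; rewrite xm // ym.
Qed.

Lemma is_root_setU1 x c z : phi z = z -> is_root x c -> is_root x (z |: c).
Proof.
move=> zfix /is_rootP[xc xn xm]; apply/is_rootP; split=> //.
  by rewrite setU1r.
by move=> y /setU1P[->|/xm//]; rewrite zfix eqxx.
Qed.

Lemma chain_setU1_phi x c : is_root x c -> chain c -> chain (phi x |: c).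
Proof.
move=> /is_rootP[xc xn xm] /chainP cc.
have key y : y \in c -> (phi x >=< y)%O.
  move=> yc; have [xy|] := boolP (x <= y)%O.
    by rewrite /Order.comparable (le_trans (phi_le x) xy).
  move=> nxy; have /eqP yfix : phi y == y by apply: contraNT nxy; apply: xm.
  have yx : (y <= x)%O.
    by have := cc x y xc yc; rewrite /Order.comparable (negbTE nxy).
  by apply/orP; right; rewrite -yfix; apply: phi_homo.
apply/chainP => y z /setU1P[->|yc] /setU1P[->|zc].
- exact: comparablexx.
- exact: key.
- by rewrite comparable_sym key.
- exact: cc.
Qed.

(* The invariant of the sequence of collapses: the remaining complex is a union
   of matched pairs together with chains of fixed points. *)
Definition root_stable X :=
  forall x c, c \in X -> is_root x c -> phi x |: c \in X.

(** Matched partners leave together: if [phi z |: c] is one of the two removed chains, uniqueness of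
    roots gives [z = x]. It cannot be [s], which misses [phi x], and if it is [phi x |: s], then [c]
    is itself one of the two. *)
Lemma root_stable_collapse X s x :
  root_stable X -> is_root x s -> phi x \notin s ->
  root_stable (X :\: [set s; phi x |: s]).
Proof.
move=> stX rxs pxs z c; rewrite !inE !negb_or => /andP[/andP[cs cps] cX] rzc.
rewrite stX // andbT.
have rzpc := is_root_setU1 (phiK z) rzc.
apply/andP; split; apply/eqP => E.
  rewrite E in rzpc; have zx := is_root_uniq rzpc rxs.
  by case/negP: pxs; rewrite -E zx setU11.
have zx : z = x.
  rewrite E in rzpc.
  exact: is_root_uniq rzpc (is_root_setU1 (phiK x) rxs).
rewrite zx in E; have [pxc|pxc] := boolP (phi x \in c).
  by case/eqP: cps; rewrite -E; apply/esym/setUidPr; rewrite sub1set.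
by case/eqP: cs; rewrite -(setU1K pxc) E setU1K.
Qed.

Lemma exists_collapsible_root X y :
  simplicial_complex X -> {in X, forall c, chain c} -> root_stable X ->
  [set y] \in X -> phi y != y ->
  exists x s, [/\ is_root x s, phi x \notin s
                & collapsible_pair X s (phi x |: s)].
Proof.
move=> /simplicial_complexP Xc Xch stX yX yn.
(* The number of elements strictly below is strictly increasing along the order, so minimizing it
   over the non-fixed vertices of [X] yields an order-minimal one. *)
pose h x := #|[set z : P | (z < x)%O]|.
pose Q x := ([set x] \in X) && (phi x != x).
have Qy : Q y by rewrite /Q yX.
case: (arg_minnP h Qy) => x /andP[xX xn] xmin {y yX yn Qy}.
(* Faces of [c] lie in [X], so a non-fixed element of [c] below [x] would be a vertex contradicting
   minimality. *)
have rootx c : c \in X -> x \in c -> is_root x c.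
  move=> cX xc; apply/is_rootP; split=> // y yc yn.
  have /xmin hxy : Q y by rewrite /Q yn (Xc _ c) ?sub1set.
  have /chainP/(_ x y xc yc) := Xch c cX.
  rewrite /Order.comparable => /orP[//|]; rewrite le_eqVlt => /predU1P[->//|yx].
  suff : h y < h x by rewrite ltnNge hxy.
  apply/proper_card/properP; split.
    by apply/subsetP => z; rewrite !inE => /lt_trans; apply.
  by exists y; rewrite !inE ?ltxx.
pose S c := [&& c \in X, x \in c & phi x \notin c].
have Sx : S [set x] by rewrite /S xX set11 inE xn.
case: (arg_maxnP (fun c => #|c|) Sx) => s /and3P[sX xs pxs] smax.
have rxs := rootx s sX xs.
exists x, s; split=> //; apply/and5P; split=> //.
- exact: stX.
- by apply/set0Pn; exists x.
- by apply/set0Pn; exists x; rewrite setU1r.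
rewrite subsetU1 cardsU1 pxs eqxx /=; apply/forall_inP => r rX.
apply/implyP => sr; have ssr := proper_sub sr.
have xr := subsetP ssr x xs.
have ssr' : s \subset r :\ phi x.
  by apply/subsetP => z zs; rewrite !inE (subsetP ssr) // andbT;
     apply: contraNneq pxs => <-.
(* Deleting [phi x] from a proper coface [r] gives a competitor of [s] that contains [s]; maximality
   of the cardinality forces equality. *)
have /smax le_rs : S (r :\ phi x).
  by rewrite /S (Xc _ r) ?subD1set // !inE xr eqxx eq_sym xn.
have sE : s = r :\ phi x by apply/eqP; rewrite eqEcard ssr'.
have pxr : phi x \in r.
  apply: contraTT sr => pxr; rewrite sE (setDidPl _) ?properxx //.
  by rewrite disjoint_sym disjoints1.
by rewrite sE setD1K.
Qed.

(** Induction on the number of simplices of [X]; each collapse preserves all four hypotheses. *)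
Lemma connect_collapse X :
  simplicial_complex X -> {in X, forall c, chain c} -> root_stable X ->
  order_complex (phi @: [set: P]) \subset X ->
  connect (@elementary_collapse P) X (order_complex (phi @: [set: P])).
Proof.
set Y := order_complex _.
have [n] := ubnP #|X|; elim: n X => // n IH X le_n Xc Xch stX YX.
have [XY|/subsetPn[c cX cY]] := boolP (X \subset Y).
  by rewrite (_ : X = Y) ?connect0 //; apply/eqP; rewrite eqEsubset XY.
have /subsetPn[y yc] : ~~ (c \subset phi @: [set: P]).
  by apply: contraNN cY => cphi; rewrite inE cphi Xch.
rewrite mem_codom_closure => yn.
have yX : [set y] \in X by apply: (simplicial_complexP _ Xc _ c); rewrite ?sub1set.
have [x [s [rxs pxs pair]]] := exists_collapsible_root Xc Xch stX yX yn.
have /and3P[sX tX _] := pair.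
(* Both chains of the pair contain the non-fixed [x], so the collapse leaves the target subcomplex
   intact. *)
have notY r : x \in r -> r \notin Y.
  have /is_rootP[_ xn _] := rxs => xr.
  rewrite inE; apply/nandP; left; apply/subsetPn; exists x => //.
  by rewrite mem_codom_closure.
have xs : x \in s by case/is_rootP: rxs.
apply: (@connect_trans _ _ (X :\: [set s; phi x |: s])).
  apply: connect1; rewrite /elementary_collapse Xc /=.
  by apply/existsP; exists s; apply/existsP; exists (phi x |: s); rewrite pair /=.
apply: IH.
- rewrite -ltnS (leq_trans _ le_n) // ltnS; apply/proper_card/properP.
  by rewrite subsetDl; split=> //; exists s; rewrite // !inE eqxx.
- exact: collapse_simplicial_complex pair.
- by move=> r /setDP[/Xch].
- exact: root_stable_collapse.
rewrite subsetD YX; apply/pred0P => r /=; apply/negP => /andP[rY].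
by rewrite !inE => /orP[] /eqP rE; move: rY; apply/negP; rewrite rE notY // setU1r.
Qed.

Lemma descending_collapses_onto :
  collapses_onto (order_complex [set: P]) (order_complex (phi @: [set: P])).
Proof.
have sub : order_complex (phi @: [set: P]) \subset order_complex [set: P].
  by apply/subsetP => c; rewrite !inE subsetT => /andP[].
rewrite /collapses_onto !order_complex_simplicial sub /=.
apply: connect_collapse => //; first exact: order_complex_simplicial.
  by move=> c; rewrite inE => /andP[].
move=> x c; rewrite !inE !subsetT /= => cc rxc.
exact: chain_setU1_phi.
Qed.

End DescendingClosure.

(** Chains depend only on comparability, which is symmetric and so does not change when the order is
    reversed. *)
Lemma order_complex_dual (d : Order.disp_t) (P : finPOrderType d)
    (A : {set P}) :
  order_complex (A : {set P^d}) = order_complex A.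
Proof.
apply/setP => c; rewrite !inE; congr andb.
by apply/chainP/chainP => h x y xc yc; rewrite comparable_sym; apply: h.
Qed.

Theorem theorem2p1 (d : Order.disp_t) (P : finPOrderType d) (phi : P -> P) :
  (descending_closure phi ->
     collapses_onto (order_complex [set: P]) (order_complex (phi @: [set: P])))
  /\
  (ascending_closure phi ->
     collapses_onto (order_complex [set: P]) (order_complex (phi @: [set: P]))).
Proof.
split=> [|[phi_homo phiK phi_ge]]; first exact: descending_collapses_onto.
have phi_desc : descending_closure (phi : P^d -> P^d).
  by split=> // x y; apply: phi_homo.
have := descending_collapses_onto phi_desc.
by rewrite !order_complex_dual.
Qed.
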